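(* Let $(X,T,\mu)$ be an aperiodic probability preserving ergodic dynamical system. Then there are a function $f\in\mathcal{F}$ and a trimming sequence $k(N)=o(N)$ for which there exist $d_N>0$ with $$\lim_{N\to\infty}\frac{S_N^{k(N)}(f)(x)}{d_N}=1\qquad\text{for }\mu\text{-a.e. }x\in X,$$ but there is another trimming sequence $k'(N)=o(N)$ with $k'(N)\ge k(N)$ for all $N$, such that for every sequence $d'_N>0$ there is an $\epsilon>0$ with $$\limsup_{N\to\infty}\mu\left(\left|\frac{S_N^{k'(N)}(f)}{d'_N}-1\right|>\epsilon\right)>0.$$
   Context: $\mathcal{F}$ is the set of measurable $f:X\to[0,\infty]$ with $\int_X f\,d\mu=\infty$ and $\mu(f=\infty)=0$. A trimming sequence is a sequence of integers $k(N)$, $N\ge1$, with $0\le k(N)\le N$. The trimmed sum is $$S_N^{k}(f)(x)=\sum_{n=0}^{N-1}f(T^nx)-\max_{0\le n_1<\dots<n_k\le N-1}\sum_{j=1}^{k}f(T^{n_j}x),$$ i.e. the Birkhoff sum with the $k$ largest terms removed (so $S_N^0$ is the full Birkhoff sum). An ergodic system is called periodic if it is (up to null sets) a rotation, i.e. cyclic permutation, of finitely many elements; aperiodic means not periodic in this sense. *)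

(* Defs.v *)
From HB Require Import structures.
From mathcomp Require Export all_boot all_order all_algebra.
From mathcomp Require Export all_classical all_reals all_analysis.
From mathcomp Require Export measurable_realfun.
Export Order.TTheory GRing.Theory Num.Theory.
Export numFieldNormedType.Exports.

Set Implicit Arguments.
Unset Strict Implicit.
Unset Printing Implicit Defensive.

Local Open Scope classical_set_scope.
Local Open Scope ring_scope.

Section dynamical_systems.
Context {d : measure_display} {R : realType} {X : measurableType d}.
Variables (mu : probability X R) (T : X -> X).

Definition probability_preserving : Prop :=
  measurable_fun [set: X] T /\
  forall A, measurable A -> mu (T @^-1` A) = mu A.

Definition ergodic : Prop :=
  forall A, measurable A -> T @^-1` A = A -> mu A = 0%E \/ mu A = 1%E.

(* Isomorphism modulo null sets with the rotation i |-> i + 1 mod p of 'I_p: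
   phi is the factor map, and the last clause says that, up to null sets, phi
   separates all measurable sets.  No point of X need be measurable as a
   singleton.  If T preserves mu, the second clause already forces the fibres
   of phi to have measure 1 / p each. *)
Definition periodic_system : Prop :=
  exists (p : nat) (phi : X -> 'I_p),
    [/\ forall i, measurable (phi @^-1` [set i]),
        {ae mu, forall x, phi (T x) = ordS (phi x)}
      & forall A, measurable A ->
          exists S : set 'I_p, mu (A `+` phi @^-1` S) = 0%E].

Definition aperiodic_system : Prop := ~ periodic_system.

Definition class_F (f : X -> \bar R) : Prop :=
  [/\ measurable_fun [set: X] f,
      forall x, (0 <= f x)%E,
      (\int[mu]_x f x = +oo)%E
    & mu [set x | f x = +oo%E] = 0%E].

End dynamical_systems.

Definition trimming_sequence (k : nat -> nat) : Prop :=
  forall N, (k N <= N)%N.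

(* The index tuples n_1 < ... < n_k <= N - 1 are the k-element subsets of 'I_N;
   for k <= N there is at least one, so the default value -oo plays no role.
   If a trimmed term is +oo the difference is +oo - +oo = -oo; for f in class_F
   this concerns a null set of points x only. *)
Definition trimmed_sum (R : realType) (X : Type) (T : X -> X)
    (f : X -> \bar R) (N k : nat) (x : X) : \bar R :=
  (\sum_(n < N) f (iter n T x)
   - \big[maxe/-oo]_(J : {set 'I_N} | #|J| == k)
       \sum_(n in J) f (iter n T x))%E.

(* Main.v *)
Require Import Defs.
From mathcomp Require Import ring lra zify.

(** The function is [f x = a (L x)], where the level [L : X -> nat] has rapidly
decaying positive tails [p j = mu (L >= j)] and the values [a j] grow so fast
that [a j * p j] is unbounded, which makes the integral infinite. Aperiodicity
provides such a level ([rapid_level_function]): if the positive probabilities of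
an ergodic system were bounded away from 0, there would be an event that cannot
be split, and its preimages would form a finite cycle ([periodic_of_atom]).

Let [W j N] count the times before [N] at which the level is at least [j]. From
some time [N_j] on, [W j N] is close to [p j * N], by the pointwise ergodic
theorem ([visits_uniform]). Since [p (j+1)] is tiny compared with [p j], the
maximal inequality keeps [W (j+1) N] below a small fraction of [p j * N] at all
times. For [N] between [N_j] and [N_(j+1)] the sequence [k] trims that small
fraction of [p j * N] terms: all terms of level above [j] and only a few of level
[j]. What remains is [a j * p j * N] up to a factor close to 1, because the lower
levels contribute at most [a (j-1) * N]. The exceptional events have summable
probabilities, so the convergence is almost sure.

At the time [N_j] the sequence [k'] trims [m_j] terms instead, where both
[W j N_j <= m_j] and [W j N_j > m_j] have probability at least 1/8. In the first
case no term of level [j] or more survives, and the trimmed sum is at most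
[a (j-1) * N_j]; in the second case one does, and it is at least [a j]. As [a j]
is chosen after [N_j], these two scales are far apart and no normalisation suits
both ([spread_not_normalizable]). A suitable [m_j] exists for arbitrarily large
times because a counter that moves by unit steps, each of them improbable,
cannot be almost deterministic and tend to infinity
([visits_not_concentrated]).

Ergodic averages are needed for indicators only. For these the maximal inequality
bounds by [mu A / lam] the probability that some average exceeds [lam]
([maximal_inequality]); for [lam > mu A] this is less than 1, so the invariant
event that the averages stay above [lam] on unboundedly long scales is null. *)

Set Implicit Arguments.
Unset Strict Implicit.
Unset Printing Implicit Defensive.

Local Open Scope classical_set_scope.
Local Open Scope ring_scope.

(** * Probabilities and counts of visits *)

Lemma exists_nat_ge (R : realType) (a b : R) : 0 < b -> exists n : nat, a <= b * n%:R.
Proof.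
move=> b0; exists (Num.truncn (a / b)).+1.
by rewrite mulrC -ler_pdivrMr// ltW// truncnS_gt.
Qed.

Section prob.
Context {d : measure_display} {R : realType} {X : measurableType d}.
Variable mu : probability X R.

Definition proba (A : set X) : R := fine (mu A).
Local Notation Pr := proba.

Lemma PrE A : measurable A -> mu A = (Pr A)%:E.
Proof. by move=> mA; rewrite /proba fineK// fin_num_measure. Qed.

Lemma Pr_ge0 A : 0 <= Pr A.
Proof. by rewrite /proba fine_ge0. Qed.

Lemma Pr_le A B : measurable A -> measurable B -> A `<=` B -> Pr A <= Pr B.
Proof.
by move=> mA mB AB; rewrite -lee_fin -!PrE// le_measure ?inE.
Qed.

Lemma Pr_setT : Pr setT = 1.
Proof. by rewrite /proba probability_setT. Qed.

Lemma Pr_set0 : Pr set0 = 0.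
Proof. by rewrite /proba measure0. Qed.

Lemma Pr_setC A : measurable A -> Pr (~` A) = 1 - Pr A.
Proof.
by move=> mA; rewrite /proba probability_setC// PrE//.
Qed.

Lemma Pr_le1 A : measurable A -> Pr A <= 1.
Proof. by move=> mA; rewrite -Pr_setT Pr_le. Qed.

Lemma Pr_setU A B : measurable A -> measurable B -> Pr (A `|` B) <= Pr A + Pr B.
Proof.
move=> mA mB; rewrite -lee_fin EFinD -!PrE//; last exact: measurableU.
exact: measureU2.
Qed.

Lemma Pr_setDI A B : measurable A -> measurable B ->
  Pr A = Pr (A `\` B) + Pr (A `&` B).
Proof.
move=> mA mB; apply: EFin_inj; rewrite EFinD -!PrE//.
- by rewrite -measureDI.
- exact: measurableI.
- exact: measurableD.
Qed.

Lemma Pr_bigcup0 (F : nat -> set X) : (forall i, measurable (F i)) ->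
  (forall i, Pr (F i) = 0) -> Pr (\bigcup_i F i) = 0.
Proof.
move=> mF F0; rewrite /proba.
have /negligible_bigcup : forall i, mu.-negligible (F i).
  move=> i; apply/negligibleP => //; have := F0 i.
  by rewrite -[0%E]/(0%:E) => <-; exact: PrE.
move/negligibleP => -> //; exact: bigcupT_measurable.
Qed.

Lemma Pr_le0 A B : measurable A -> measurable B -> A `<=` B -> Pr B = 0 -> Pr A = 0.
Proof.
by move=> mA mB AB B0; apply/eqP; rewrite eq_le Pr_ge0 -B0 Pr_le.
Qed.

Lemma Pr_meet A B : measurable A -> measurable B -> 1 < Pr A + Pr B ->
  exists x, A x /\ B x.
Proof.
move=> mA mB AB; apply: contrapT => /forallNP nAB.
have : Pr A <= Pr (~` B).
  apply: Pr_le => //; first exact: measurableC.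
  by move=> x Ax Bx; apply: (nAB x).
by rewrite Pr_setC//; lra.
Qed.

Lemma Pr_nonincreasing (F : nat -> set X) (e : R) :
  (forall i, measurable (F i)) -> (forall i, F i.+1 `<=` F i) ->
  Pr (\bigcap_i F i) < e -> exists i, Pr (F i) < e.
Proof.
move=> mF dF Fe.
have mI : measurable (\bigcap_i F i) by exact: bigcapT_measurable.
have /= h : mu \o F @ \oo --> mu (\bigcap_i F i).
  apply: nonincreasing_cvg_mu => //.
    by rewrite (le_lt_trans (probability_le1 _ _))// ltry.
  by apply/nonincreasing_seqP => n; apply/subsetPset; exact: dF.
have : \forall i \near \oo, ((mu \o F) i < e%:E)%E.
  by apply: (h (fun y => (y < e%:E)%E)); apply: open_ereal_lt'; rewrite PrE// lte_fin.
move=> [i _ /(_ i (leqnn i))/=]; rewrite PrE// lte_fin => ?; by exists i.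
Qed.

Lemma Pr_nondecreasing (F : nat -> set X) (e : R) :
  (forall i, measurable (F i)) -> (forall i, F i `<=` F i.+1) ->
  (forall i, Pr (F i) <= e) -> Pr (\bigcup_i F i) <= e.
Proof.
move=> mF dF Fe; rewrite leNgt; apply/negP => he.
have mU : measurable (\bigcup_i F i) by exact: bigcupT_measurable.
have [||| i] := @Pr_nonincreasing (fun i => ~` F i) (1 - e).
- by move=> i; exact: measurableC.
- by move=> i x /= h /dF.
- by rewrite -setC_bigcup Pr_setC//; lra.
- by rewrite Pr_setC//; have := Fe i; lra.
Qed.

Lemma measurable_nat_pred (h : X -> nat) (Q : set nat) :
  measurable_fun setT h -> measurable [set x | Q (h x)].
Proof. by move=> mh; rewrite -[X in measurable X]setTI; exact: mh. Qed.

Lemma PrC_ae (A : set X) (P : X -> Prop) : measurable A -> Pr A = 0 ->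
  (forall x, ~ A x -> P x) -> {ae mu, forall x, P x}.
Proof.
move=> mA A0 AP; exists A; split => //; first by rewrite PrE// A0.
by move=> x /= nP; apply: contrapT => /AP.
Qed.
End prob.

Section visits.
Context {X : Type}.
Variable T : X -> X.

Definition visits (A : set X) (n : nat) (x : X) : nat :=
  (\sum_(i < n) (iter i T x \in A : nat))%N.

Lemma visits0 A x : visits A 0 x = 0%N.
Proof. by rewrite /visits big_ord0. Qed.

Lemma visitsD A m n x :
  visits A (m + n) x = (visits A m x + visits A n (iter m T x))%N.
Proof.
rewrite /visits big_split_ord /=; congr addn.
by apply: eq_bigr => i _; rewrite addnC iterD.
Qed.

Lemma visitsS A n x : visits A n.+1 x = (visits A n x + (iter n T x \in A))%N.
Proof. by rewrite /visits big_ord_recr. Qed.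

Lemma visits_recl A n x : visits A n.+1 x = ((x \in A) + visits A n (T x))%N.
Proof. by rewrite -add1n visitsD {1}/visits big_ord1. Qed.

Lemma visits_le A n x : (visits A n x <= n)%N.
Proof.
elim: n => [|n IH]; first by rewrite visits0.
by rewrite visitsS; case: (_ \in _) => /=; lia.
Qed.

Lemma visits_mono A m n x : (m <= n)%N -> (visits A m x <= visits A n x)%N.
Proof. by move=> /subnKC <-; rewrite visitsD leq_addr. Qed.

Lemma visitsC A n x : (visits A n x + visits (~` A) n x = n)%N.
Proof.
elim: n => [|n IH]; first by rewrite !visits0.
by rewrite !visitsS in_setC; case: (_ \in A) => /=; lia.
Qed.

Lemma visits_gt0 A n x : (0 < visits A n x)%N -> exists2 i, (i < n)%N & A (iter i T x).
Proof.
elim: n => [|n IH]; first by rewrite visits0.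
rewrite visitsS; have [/set_mem Ax _|_] := boolP (_ \in A); first by exists n.
by rewrite addn0 => /IH[i lin Ai]; exists i => //; exact: ltnW.
Qed.

(** Cover the times spent in [E] greedily by disjoint blocks of length at most [K]
each of which spends a proportion at least [lam] of its time in [A]. The last
block may extend beyond time [N], hence the extra [K]. *)
Lemma visits_cover (R : realType) (A E : set X) (lam : R) (K : nat) :
  0 <= lam ->
  (forall y, E y -> exists l, [/\ (0 < l)%N, (l <= K)%N &
     lam * l%:R <= (visits A l y)%:R]) ->
  forall N x, lam * (visits E N x)%:R <= (visits A (N + K) x)%:R.
Proof.
move=> lam0 EA N; elim/ltn_ind: N => -[|N] IH x.
  by rewrite visits0 mulr0.
have [Ex|nEx] := boolP (x \in E); last first.
  rewrite visits_recl (negbTE nEx) add0n addSn visits_recl natrD.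
  by rewrite (le_trans (IH N _ (T x)))// lerDr.
have [l [l0 lK hl]] := EA _ (set_mem Ex).
have [lN|Nl] := leqP l N.+1; last first.
  rewrite (@le_trans _ _ (lam * l%:R))//.
    by rewrite ler_wpM2l// ler_nat (leq_trans (visits_le _ _ _))// ltnW.
  by rewrite (le_trans hl)// ler_nat; apply: visits_mono; lia.
rewrite -(subnKC lN) -addnA !visitsD !natrD mulrDr lerD//.
  by rewrite (le_trans _ hl)// ler_wpM2l// ler_nat visits_le.
by rewrite -natrD -visitsD; apply: IH; lia.
Qed.

End visits.

(** * The pointwise ergodic theorem for events *)

Section ergodic_averages.
Context {d : measure_display} {R : realType} {X : measurableType d}.
Variables (mu : probability X R) (T : X -> X).
Hypothesis T_pres : probability_preserving mu T.
Local Notation Pr := (proba mu).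
Local Notation visits := (visits T).

Lemma measurable_iter n : measurable_fun setT (iter n T).
Proof.
elim: n => [|n IH]; first exact: measurable_id.
by apply: measurableT_comp => //; case: T_pres.
Qed.

Lemma measurable_iter_preimage n A : measurable A ->
  measurable (iter n T @^-1` A).
Proof. by move=> mA; rewrite -[X in measurable X]setTI; exact: measurable_iter. Qed.

Lemma Pr_iter n A : measurable A -> Pr (iter n T @^-1` A) = Pr A.
Proof.
move=> mA; elim: n => [//|n IH].
have -> : iter n.+1 T @^-1` A = T @^-1` (iter n T @^-1` A).
  by apply/seteqP; split=> x; rewrite /preimage /mkset iterSr.
rewrite -IH /proba; case: T_pres => _ -> //; exact: measurable_iter_preimage.
Qed.

Lemma measurable_visits A n : measurable A -> measurable_fun setT (visits A n).
Proof.
move=> mA; elim: n => [|n IH].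
  have -> : visits A 0 = cst 0%N by apply/funext => x; rewrite visits0.
  exact: measurable_cst.
have -> : visits A n.+1 = (fun x => visits A n x + (iter n T x \in A))%N.
  by apply/funext => x; rewrite visitsS.
apply: measurable_fun_addn => // _ Y _; rewrite setTI.
have -> : (fun x => (iter n T x \in A : nat)) @^-1` Y =
    (iter n T @^-1` A `&` [set x | Y 1%N]) `|`
    (~` (iter n T @^-1` A) `&` [set x | Y 0%N]).
  apply/seteqP; split => x /=.
    have [/set_mem|/negP nA] := boolP (_ \in A) => /=; first by left.
    by right; split => // /mem_set.
  by move=> [[/mem_set ->]|[nA]] //; have [/set_mem|] := boolP (_ \in A).
have mY (P : Prop) : measurable [set x : X | P].
  have [p|np] := pselect P.
    by rewrite (_ : mkset _ = setT)//; apply/seteqP; split.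
  by rewrite (_ : mkset _ = set0)//; apply/seteqP; split.
apply: measurableU; apply: measurableI => //; last apply: measurableC;
  exact: measurable_iter_preimage.
Qed.

Lemma measurable_visits_pred A n (Q : set nat) : measurable A ->
  measurable [set x | Q (visits A n x)].
Proof. by move=> mA; apply: measurable_nat_pred; exact: measurable_visits. Qed.

Lemma integral_visits A n : measurable A ->
  (\int[mu]_x (visits A n x)%:R%:E = (n%:R * Pr A)%:E)%E.
Proof.
move=> mA.
transitivity (\int[mu]_x (\sum_(i < n) (\1_(iter i T @^-1` A) x)%:E))%E.
  apply: eq_integral => x _.
  by rewrite sumEFin /visits natr_sum.
rewrite ge0_integral_sum//; last first.
  move=> i; apply/measurable_EFinP; apply: measurable_indic.
  exact: measurable_iter_preimage.
rewrite (eq_bigr (fun=> (Pr A)%:E)).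
  by rewrite sumEFin sumr_const card_ord mulr_natl.
move=> i _; rewrite integral_indic//; last exact: measurable_iter_preimage.
by rewrite setIT -(Pr_iter i mA) -PrE//; exact: measurable_iter_preimage.
Qed.

Lemma measurable_frequent A (lam : R) : measurable A ->
  measurable [set x | exists n, (0 < n)%N /\ lam * n%:R <= (visits A n x)%:R].
Proof.
move=> mA.
rewrite (_ : mkset _ = \bigcup_(n in [set n | (0 < n)%N])
    [set x | lam * n%:R <= (visits A n x)%:R]).
  apply: bigcup_measurable => n _.
  exact: (measurable_visits_pred n (fun m => lam * n%:R <= m%:R)).
by apply/seteqP; split => x /= [n]; [move=> []; exists n|exists n].
Qed.

(** For averages over at most [K] steps, integrate [visits_cover], divide by [N] and
let [N] tend to infinity; then let [K] increase. *)
Lemma maximal_inequality A (lam : R) : measurable A -> 0 <= lam ->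
  lam * Pr [set x | exists n, (0 < n)%N /\ lam * n%:R <= (visits A n x)%:R] <= Pr A.
Proof.
move=> mA lam0.
pose E K := [set x | exists n,
  [/\ (0 < n)%N, (n <= K)%N & lam * n%:R <= (visits A n x)%:R]].
have mE K : measurable (E K).
  have -> : E K = \bigcup_(n in [set n | (0 < n <= K)%N])
      [set x | lam * n%:R <= (visits A n x)%:R].
    apply/seteqP; split => x /= [n].
      by move=> [n0 nK h]; exists n => //=; rewrite n0.
    by move=> /= /andP[n0 nK] h; exists n.
  apply: bigcup_measurable => n _.
  exact: (measurable_visits_pred n (fun m => lam * n%:R <= m%:R)).
have hE K : lam * Pr (E K) <= Pr A.
  apply/ler_addgt0Pr => e e0.
  pose N := (Num.truncn (K%:R * Pr A / e)).+1.
  have hN : K%:R * Pr A <= N%:R * e.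
    by rewrite -ler_pdivrMr// ltW// truncnS_gt.
  have : lam * (N%:R * Pr (E K)) <= (N + K)%:R * Pr A.
    rewrite -lee_fin EFinM -!integral_visits// -ge0_integralZl//.
    - apply: ge0_le_integral => //.
      + by move=> x _; rewrite -EFinM lee_fin mulr_ge0.
      + apply: measurable_funeM; apply/measurable_EFinP.
        by apply: measurableT_comp => //; exact: measurable_visits.
      + apply/measurable_EFinP.
        by apply: measurableT_comp => //; exact: measurable_visits.
      + move=> x _; rewrite -EFinM lee_fin; apply: visits_cover => //.
    - apply/measurable_EFinP.
      by apply: measurableT_comp => //; exact: measurable_visits.
  have N0 : 0 < N%:R :> R by rewrite ltr0n.
  rewrite natrD mulrDl mulrCA => h.
  rewrite -(ler_pM2l N0) mulrDr; lra.
have [->|lamN0] := eqVneq lam 0; first by rewrite mul0r Pr_ge0.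
have {lamN0 lam0}lam0 : 0 < lam by rewrite lt_neqAle eq_sym lamN0.
rewrite mulrC -ler_pdivlMr//.
have -> : [set x | exists n, (0 < n)%N /\ lam * n%:R <= (visits A n x)%:R] =
    \bigcup_K E K.
  apply/seteqP; split => x /=.
    by move=> [n [n0 h]]; exists n => //; exists n.
  by move=> [K _ [n [n0 _ h]]]; exists n.
apply: Pr_nondecreasing => // K.
  by move=> x [n [n0 nK h]]; exists n; split => //; exact: leqW.
by rewrite ler_pdivlMr// mulrC.
Qed.

Hypothesis T_erg : ergodic mu T.

Definition above_mean A (c : R) : set X :=
  [set x | forall K, exists n, c * n%:R + K%:R < (visits A n x)%:R].

Lemma measurable_above_mean A c : measurable A -> measurable (above_mean A c).
Proof.
move=> mA.
have -> : above_mean A c =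
    \bigcap_K \bigcup_n [set x | c * n%:R + K%:R < (visits A n x)%:R].
  apply/seteqP; split => x /= h K; first by have [n ?] := h K; exists n.
  by have [n _ ?] := h K I; exists n.
apply: bigcapT_measurable => K; apply: bigcupT_measurable => n.
exact: (measurable_visits_pred n (fun m => c * n%:R + K%:R < m%:R)).
Qed.

(** The event [above_mean A c] is strictly invariant, because replacing [x] by [T x]
and shifting [n] by one changes [visits A n x - c * n] by a bounded amount. The
maximal inequality bounds its probability by [Pr A / c < 1]. *)
Lemma visits_above_mean_null A (c : R) : measurable A -> Pr A < c ->
  Pr (above_mean A c) = 0.
Proof.
move=> mA Ac; have c0 : 0 < c by apply: le_lt_trans Ac; exact: Pr_ge0.
set D := above_mean A c; have mD : measurable D := measurable_above_mean c mA.
have DT : T @^-1` D = D.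
  apply/seteqP; split => x /= h K.
    have [K' hK'] := exists_nat_ge c (@ltr01 R).
    have [n hn] := h (K + K')%N.
    exists n.+1; rewrite visits_recl natrD.
    have : 0 <= (x \in A : nat)%:R :> R by [].
    by move: hn hK'; rewrite natrD -(addn1 n) natrD; lra.
  have [[|n]] := h K.+1.
    by rewrite visits0 mulr0 add0r ltrn0.
  rewrite visits_recl natrD -(addn1 n) -(addn1 K) !natrD => hn; exists n.
  have : (x \in A : nat)%:R <= 1 :> R by case: (_ \in _).
  by move: hn; lra.
case: (T_erg mD DT) => mu01; first by rewrite /proba mu01.
have := maximal_inequality mA (ltW c0); set E := [set x | _] => hE.
have mE : measurable E by exact: measurable_frequent.
have : Pr D <= Pr E.
  apply: Pr_le => // x /(_ 0%N)[[|n]]; first by rewrite visits0 mulr0 add0r ltrn0.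
  by rewrite addr0 => h; exists n.+1; split => //; exact: ltW.
rewrite {1}/proba mu01 /= => E1.
have : c * 1 <= c * Pr E by rewrite ler_pM2l.
lra.
Qed.

Lemma measurable_deviation A (e : R) n : measurable A ->
  measurable [set x | e * n%:R < `|(visits A n x)%:R - Pr A * n%:R|].
Proof.
move=> mA.
exact: (measurable_visits_pred n (fun m => e * n%:R < `|m%:R - Pr A * n%:R|)).
Qed.

Lemma measurable_tail_deviation A (e : R) M : measurable A ->
  measurable [set x | exists n, (M <= n)%N /\
     e * n%:R < `|(visits A n x)%:R - Pr A * n%:R|].
Proof.
move=> mA.
rewrite (_ : mkset _ = \bigcup_(n in [set n | (M <= n)%N])
    [set x | e * n%:R < `|(visits A n x)%:R - Pr A * n%:R|]).
  by apply: bigcup_measurable => n _; exact: measurable_deviation.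
by apply/seteqP; split => x /= [n]; [move=> []; exists n|exists n].
Qed.

(** The pointwise ergodic theorem for the indicator of [A], in Egorov form: the
upper bound on the averages is [visits_above_mean_null] for [A], the lower bound
is the same statement for the complement of [A]. *)
Lemma visits_uniform A (e eta : R) : measurable A -> 0 < e -> 0 < eta ->
  exists M, Pr [set x | exists n, (M <= n)%N /\
     e * n%:R < `|(visits A n x)%:R - Pr A * n%:R|] < eta.
Proof.
move=> mA e0 eta0; apply: Pr_nonincreasing.
- by move=> M; exact: measurable_tail_deviation.
- by move=> M x /= [n [Mn h]]; exists n; split => //; exact: ltnW.
pose D := above_mean.
have mAC := measurableC mA.
have D1 : Pr (D A (Pr A + e / 2)) = 0 by apply: visits_above_mean_null => //; lra.
have D2 : Pr (D (~` A) (1 - Pr A + e / 2)) = 0.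
  by apply: visits_above_mean_null => //; rewrite Pr_setC//; lra.
apply: (@le_lt_trans _ _
    (Pr (D A (Pr A + e / 2) `|` D (~` A) (1 - Pr A + e / 2)))); last first.
  apply: le_lt_trans eta0; rewrite (le_trans (Pr_setU _ _ _))// ?D1 ?D2 ?addr0//;
  exact: measurable_above_mean.
apply: Pr_le.
- by apply: bigcapT_measurable => M; exact: measurable_tail_deviation.
- by apply: measurableU; exact: measurable_above_mean.
move=> x hx; apply: contrapT.
move=> /not_orP[/existsNP[K1 /forallNP h1] /existsNP[K2 /forallNP h2]].
have e20 : 0 < e / 2 by lra.
have [M hM] := exists_nat_ge (K1%:R + K2%:R) e20.
have [n [Mn]] := hx M I; apply/negP; rewrite -leNgt.
have := h1 n => /negP; rewrite -leNgt => {}h1.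
have := h2 n => /negP; rewrite -leNgt => {}h2.
have : (visits A n x)%:R + (visits (~` A) n x)%:R = n%:R :> R by rewrite -natrD visitsC.
have : e / 2 * M%:R <= e / 2 * n%:R by rewrite ler_pM2l// ler_nat.
have : 0 <= K1%:R :> R by [].
have : 0 <= K2%:R :> R by [].
by rewrite ler_norml; lra.
Qed.

Lemma measurable_never_returns C : measurable C ->
  measurable [set x | forall n, ~ C (iter n.+1 T x)].
Proof.
move=> mC; rewrite (_ : mkset _ = \bigcap_n ~` (iter n.+1 T @^-1` C)).
  apply: bigcapT_measurable => n; apply: measurableC.
  exact: (measurable_iter_preimage n.+1).
by apply/seteqP; split => x /= h n; [move=> _; exact: h|exact: (h n I)].
Qed.

(** Otherwise the points that make at most one visit would contradict the positive
limiting frequency [Pr C] of the visits. *)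
Lemma never_returns_null C : measurable C -> 0 < Pr C ->
  Pr [set x | forall n, ~ C (iter n.+1 T x)] = 0.
Proof.
move=> mC C0; set Z := [set x | _].
have mZ : measurable Z by exact: measurable_never_returns.
apply/eqP; rewrite eq_le Pr_ge0 andbT; apply/ler_addgt0Pr => e e0; rewrite add0r.
have C20 : 0 < Pr C / 2 by lra.
have [M hM] := visits_uniform mC C20 e0.
apply: le_trans (ltW hM).
apply: Pr_le => //; first exact: measurable_tail_deviation.
move=> x Zx; have [K hK] := exists_nat_ge 2 C20.
exists (M + K).+1; split; first by lia.
have : (visits C (M + K).+1 x <= 1)%N.
  rewrite visits_recl; have -> : visits C (M + K) (T x) = 0%N.
    apply/eqP; rewrite -leqn0 leqNgt; apply/negP => /(@visits_gt0 _ T)[i _].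
    by rewrite -iterSr => /Zx.
  by case: (_ \in _).
rewrite -(ler_nat R) => v1; rewrite lter_normr; apply/orP; right.
have : Pr C / 2 * K%:R <= Pr C / 2 * (M + K).+1%:R by rewrite ler_pM2l// ler_nat; lia.
lra.
Qed.

(** Otherwise, from some time on, the number of visits before time [N] would equal
its lower 1/8-quantile [m N] with probability more than 3/4. Then [m] could not
increase, since a visit at time [N] has probability at most 1/4; but the number of
visits tends to infinity. *)
Lemma visits_not_concentrated A M : measurable A -> 0 < Pr A -> Pr A <= 1 / 4 ->
  exists N m, [/\ (M <= N)%N, 1 / 8 <= Pr [set x | (visits A N x <= m)%N] &
    1 / 8 <= Pr [set x | (m < visits A N x)%N]].
Proof.
move=> mA A0 A4.
have mle N m : measurable [set x | (visits A N x <= m)%N].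
  exact: (measurable_visits_pred N (fun v => (v <= m)%N)).
have mlt N m : measurable [set x | (m < visits A N x)%N].
  exact: (measurable_visits_pred N (fun v => (m < v)%N)).
have mge N m : measurable [set x | (m <= visits A N x)%N].
  exact: (measurable_visits_pred N (fun v => (m <= v)%N)).
have meq N m : measurable [set x | visits A N x = m].
  exact: (measurable_visits_pred N (fun v => v = m)).
have med N : exists m, 1 / 8 <= Pr [set x | (visits A N x <= m)%N].
  exists N; rewrite (_ : mkset _ = setT) ?Pr_setT; first lra.
  by apply/seteqP; split => // x _ /=; exact: visits_le.
pose m N := ex_minn (med N).
have m1 N : 1 / 8 <= Pr [set x | (visits A N x <= m N)%N] by rewrite /m; case: ex_minnP.
have m2 N : 7 / 8 < Pr [set x | (m N <= visits A N x)%N].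
  case mE : (m N) => [|n].
    by rewrite (_ : mkset _ = setT) ?Pr_setT; [lra|apply/seteqP; split].
  have -> : [set x | (n < visits A N x)%N] = ~` [set x | (visits A N x <= n)%N].
    by apply/seteqP; split => x /=; rewrite ltnNge => /negP.
  rewrite Pr_setC//; suff : Pr [set x | (visits A N x <= n)%N] < 1 / 8 by lra.
  rewrite ltNge; apply/negP => h; move: mE; rewrite /m; case: ex_minnP => k _ /(_ _ h).
  by move=> + kn; rewrite kn ltnn.
apply: contrapT => /forallNP hno.
have m3 N : (M <= N)%N -> Pr [set x | (m N < visits A N x)%N] < 1 / 8.
  move=> MN; rewrite ltNge; apply/negP => h; apply: (hno N); exists (m N); split => //.
have m4 N : (M <= N)%N -> 3 / 4 < Pr [set x | visits A N x = m N].
  move=> MN; have := m2 N; have := m3 N MN.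
  have : Pr [set x | (m N <= visits A N x)%N] <=
      Pr ([set x | visits A N x = m N] `|` [set x | (m N < visits A N x)%N]).
    apply: Pr_le => //; first exact: measurableU.
    by move=> x /=; rewrite leq_eqVlt => /orP[/eqP|]; [left|right].
  have := @Pr_setU _ _ _ mu _ _ (meq N (m N)) (mlt N (m N)).
  lra.
(* With positive probability the counts before [N] and [N.+1] both take their likely
value and there is no visit at time [N]. *)
have mS N : (M <= N)%N -> m N.+1 = m N.
  move=> MN.
  have [||x [/= hN1 [hN nA]]] := @Pr_meet _ _ _ mu [set x | visits A N.+1 x = m N.+1]
      ([set x | visits A N x = m N] `\` iter N T @^-1` A) (meq _ _) _.
  - by apply: measurableD => //; exact: measurable_iter_preimage.
  - have := m4 _ MN; have := m4 _ (leqW MN); have := Pr_iter N mA.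
    have := @Pr_setDI _ _ _ mu _ _ (meq N (m N)) (measurable_iter_preimage N mA).
    have : Pr ([set x | visits A N x = m N] `&` iter N T @^-1` A) <=
        Pr (iter N T @^-1` A).
      apply: Pr_le; last by apply: subIsetr.
        by apply: measurableI => //; exact: measurable_iter_preimage.
      exact: measurable_iter_preimage.
    lra.
  - rewrite -hN1 -hN visitsS.
    by have [/set_mem//|] := boolP (_ \in _); rewrite addn0.
have mM N : m (M + N)%N = m M.
  by elim: N => [|N IH]; rewrite ?addn0// addnS mS// leq_addr.
have A20 : 0 < Pr A / 2 by lra.
have q0 : 0 < 1 / 8 :> R by lra.
have [M1 hM1] := visits_uniform mA A20 q0.
have [K hK] := exists_nat_ge ((m M)%:R + 1) A20.
pose N := (M + (M1 + K))%N.
have : 3 / 4 < Pr [set x | visits A N x = m N] by apply: m4; rewrite /N leq_addr.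
suff : Pr [set x | visits A N x = m N] <=
    Pr [set x | exists n, (M1 <= n)%N /\
      Pr A / 2 * n%:R < `|(visits A n x)%:R - Pr A * n%:R|].
  by move: hM1; lra.
apply: Pr_le => //; first exact: measurable_tail_deviation.
move=> x /= hx; exists N; split; first by rewrite /N; lia.
rewrite hx mM lter_normr; apply/orP; right.
have : Pr A / 2 * K%:R <= Pr A / 2 * N%:R by rewrite ler_pM2l// ler_nat /N; lia.
by lra.
Qed.

End ergodic_averages.

(** * Small events in aperiodic systems *)

Lemma measurable_finite_bits d (X : measurableType d) n (F : 'I_n -> set X)
    (Q : {ffun 'I_n -> bool} -> Prop) :
  (forall i, measurable (F i)) -> measurable [set x | Q [ffun i => x \in F i]].
Proof.
move=> mF.
have -> : [set x | Q [ffun i => x \in F i]] =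
    \bigcup_(b in [set b | Q b]) \bigcap_(i in [set: 'I_n])
      (if b i then F i else ~` F i).
  apply/seteqP; split => x /=.
    move=> Qx; exists [ffun i => x \in F i] => // i _.
    by rewrite ffunE; case: ifPn => [/set_mem|/negP h /mem_set].
  move=> [b Qb hb]; suff -> : [ffun i => x \in F i] = b by [].
  apply/ffunP => i; rewrite ffunE; have := hb i I.
  by case: (b i) => [/mem_set|nF]//; apply/negbTE/negP => /set_mem.
apply: fin_bigcup_measurable => //= b _.
apply: fin_bigcap_measurable => //= i _.
by case: ifP => _ //; exact: measurableC.
Qed.

Section small_sets.
Context {d : measure_display} {R : realType} {X : measurableType d}.
Variables (mu : probability X R) (T : X -> X).
Hypothesis T_pres : probability_preserving mu T.
Hypothesis T_erg : ergodic mu T.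
Local Notation Pr := (proba mu).

Lemma ergodic_hits B C : measurable B -> measurable C -> 0 < Pr B -> 0 < Pr C ->
  exists n, 0 < Pr (B `&` iter n.+1 T @^-1` C).
Proof.
move=> mB mC B0 C0; apply: contrapT => /forallNP hn.
have mI n : measurable (B `&` iter n.+1 T @^-1` C).
  by apply: measurableI => //; apply: (measurable_iter_preimage T_pres n.+1).
have N0 := never_returns_null T_pres T_erg mC C0.
have U0 : Pr (\bigcup_n (B `&` iter n.+1 T @^-1` C)) = 0.
  apply: Pr_bigcup0 => // n; apply/eqP; rewrite eq_le Pr_ge0 andbT leNgt.
  exact/negP/hn.
have mN := measurable_never_returns T_pres mC.
have mU : measurable (\bigcup_n (B `&` iter n.+1 T @^-1` C)) by exact: bigcupT_measurable.
have : Pr B <= 0; last by rewrite leNgt B0.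
apply: (@le_trans _ _ (Pr ([set x | forall n, ~ C (iter n.+1 T x)] `|`
    \bigcup_n (B `&` iter n.+1 T @^-1` C)))).
  apply: Pr_le => //; first exact: measurableU.
  move=> x Bx.
  have [|/existsNP[n /contrapT Cn]] := pselect (forall n, ~ C (iter n.+1 T x)).
    by left.
  by right; exists n.
by rewrite (le_trans (Pr_setU _ mN mU))// N0 U0 addr0.
Qed.

(** The hypothesis says that no event at most as probable as [A] can be split; it
applies to all preimages of [A], which therefore coincide or are disjoint up to null
events. If [p.+1] is the least possible return time, almost every orbit visits [A]
exactly once every [p.+1] steps, and the phase [phi x] is the [i] such that the
next visit is due after [p - i] steps. *)
Lemma periodic_of_atom A :
  measurable A -> 0 < Pr A ->
  (forall B S, measurable B -> measurable S -> Pr B <= Pr A ->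
     Pr (B `&` S) = 0 \/ Pr (B `\` S) = 0) ->
  periodic_system mu T.
Proof.
move=> mA A0 atom.
have mi n : measurable (iter n T @^-1` A) by exact: (measurable_iter_preimage T_pres).
have ret := ergodic_hits mA mA A0 A0.
pose p := ex_minn ret.
have p1 : 0 < Pr (A `&` iter p.+1 T @^-1` A) by rewrite /p; case: ex_minnP.
have p2 q : (q < p)%N -> Pr (A `&` iter q.+1 T @^-1` A) = 0.
  rewrite ltnNge => /negP pq; apply/eqP; rewrite eq_le Pr_ge0 andbT leNgt.
  by apply/negP => h; apply: pq; rewrite /p; case: ex_minnP => m _; apply.
have AB : Pr (A `\` iter p.+1 T @^-1` A) = 0.
  by have [h|//] := atom A _ mA (mi p.+1) (lexx _); move: p1; rewrite h ltxx.
have BA : Pr (iter p.+1 T @^-1` A `\` A) = 0.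
  have := @Pr_setDI _ _ _ mu _ _ mA (mi p.+1).
  have := @Pr_setDI _ _ _ mu _ _ (mi p.+1) mA.
  by rewrite (Pr_iter T_pres p.+1 mA) AB [iter _ _ @^-1` A `&` A]setIC; lra.
(* Orbits that avoid [Z] visit [A] exactly with period [p.+1], if at all. *)
pose Z := (A `\` iter p.+1 T @^-1` A) `|` (iter p.+1 T @^-1` A `\` A) `|`
  \bigcup_(q in [set q | (q < p)%N]) (A `&` iter q.+1 T @^-1` A).
have mq : measurable (\bigcup_(q in [set q | (q < p)%N]) (A `&` iter q.+1 T @^-1` A)).
  by apply: bigcup_measurable => q _; apply: measurableI => //; exact: (mi q.+1).
have mAB : measurable (A `\` iter p.+1 T @^-1` A).
  by apply: measurableD => //; exact: (mi p.+1).
have mBA : measurable (iter p.+1 T @^-1` A `\` A).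
  by apply: measurableD => //; exact: (mi p.+1).
have mZ : measurable Z by apply: measurableU => //; exact: measurableU.
have q0 : Pr (\bigcup_(q in [set q | (q < p)%N]) (A `&` iter q.+1 T @^-1` A)) = 0.
  rewrite (_ : bigcup _ _ =
    \bigcup_q (if (q < p)%N then A `&` iter q.+1 T @^-1` A else set0)).
    apply: Pr_bigcup0 => q; case: ifPn => // qp.
    - by apply: measurableI => //; exact: (mi q.+1).
    - exact: p2.
    - exact: Pr_set0.
  apply/seteqP; split => x [q].
    by move=> /= qp h; exists q => //; rewrite qp.
  by move=> _; case: ifPn => // qp h; exists q.
have Z0 : Pr Z = 0.
  apply/eqP; rewrite eq_le Pr_ge0 andbT (le_trans (Pr_setU _ _ _))//.
    exact: measurableU.
  by rewrite q0 addr0 (le_trans (Pr_setU _ _ _))// AB BA addr0.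
pose N := (\bigcup_n iter n T @^-1` Z) `|`
  [set x | forall n, ~ A (iter n.+1 T x)].
have mN1 : measurable (\bigcup_n iter n T @^-1` Z).
  by apply: bigcupT_measurable => n; exact: (measurable_iter_preimage T_pres).
have mN2 := measurable_never_returns T_pres mA.
have mN : measurable N by exact: measurableU.
have N0 : Pr N = 0.
  apply/eqP; rewrite eq_le Pr_ge0 andbT (le_trans (Pr_setU _ _ _))//.
  rewrite Pr_bigcup0; last 2 first.
  - by move=> n; exact: (measurable_iter_preimage T_pres).
  - by move=> n; rewrite (Pr_iter T_pres).
  by rewrite add0r (never_returns_null T_pres T_erg mA A0).
pose F (i : 'I_p.+1) := iter (p - i) T @^-1` A.
pose ph (b : {ffun 'I_p.+1 -> bool}) := odflt ord0 [pick i | b i].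
pose phi x := ph [ffun i => x \in F i].
have mphi (S : set 'I_p.+1) : measurable (phi @^-1` S).
  by apply: (@measurable_finite_bits _ _ _ F (fun b => S (ph b))) => i; exact: mi.
have phiE y (i : 'I_p.+1) :
    (forall n, ~ Z (iter n T y)) -> A (iter (p - i) T y) -> phi y = i.
  move=> nZ Ai; rewrite /phi /ph.
  have no a b : (a < b)%N -> (b <= p)%N -> A (iter a T y) -> ~ A (iter b T y).
    move=> ab bp Aa Ab; apply: (nZ a); right; exists (b - a).-1 => /=; first by lia.
    by split => //; rewrite -iterS -iterD; congr (A (iter _ T y)) : Ab; lia.
  case: pickP => [j|/(_ i)]; rewrite ffunE /F; last by move/negP; case; exact/mem_set.
  move=> /set_mem /= Aj; apply/val_inj => /=.
  have := ltn_ord i; have := ltn_ord j; rewrite !ltnS => jp ip.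
  have [h|h|h] := ltngtP (p - i)%N (p - j)%N; [|  |lia].
  - by case: (no _ _ h (leq_subr _ _) Ai Aj).
  - by case: (no _ _ h (leq_subr _ _) Aj Ai).
have good x : ~ N x -> exists2 i : 'I_p.+1, A (iter (p - i) T x) & phi x = i.
  move=> nN; have nZ n : ~ Z (iter n T x) by move=> h; apply: nN; left; exists n.
  suff [i ip Ai] : exists2 i, (i <= p)%N & A (iter i T x).
    have ip' : (p - i < p.+1)%N by lia.
    have Ai' : A (iter (p - Ordinal ip') T x) by rewrite /= subKn.
    by exists (Ordinal ip') => //; exact: phiE.
  have [n An] : exists n, A (iter n T x).
    apply: contrapT => /forallNP h; apply: nN; right => n; exact: h.
  (* A visit at time [n > p] comes from one at time [n - p.+1]. *)
  elim/ltn_ind: n An => n IH An.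
  have [np|pn] := leqP n p; first by exists n.
  apply: (IH (n - p.+1)%N); first by lia.
  apply: contrapT => nA; apply: (nZ (n - p.+1)%N); left; right; split => //=.
  by rewrite -iterS -iterD subnKC.
exists p.+1, phi; split => //.
- apply: (PrC_ae mN N0) => x nN; have [i Ai ->] := good x nN.
  have nZ n : ~ Z (iter n T x) by move=> h; apply: nN; left; exists n.
  apply: phiE => [n|]; first by rewrite -iterSr; exact: nZ.
  rewrite -iterSr /=; have := ltn_ord i; rewrite ltnS leq_eqVlt => /orP[/eqP ip|ip].
    rewrite ip modnn subn0 -iterS.
    apply: contrapT => nA; apply: (nZ 0%N); left; left; split => //=.
    by move: Ai; rewrite ip subnn.
  by rewrite modn_small// -iterS subnSK.
- (* Each phase lies in [S0] or in its complement, up to a null event. *)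
  move=> S0 mS0; pose S := [set i | 0 < Pr (phi @^-1` [set i] `&` S0)].
  exists S; have mS := mphi S.
  have mE : measurable (S0 `+` phi @^-1` S) by apply: measurableU; exact: measurableD.
  rewrite (PrE mu mE); congr EFin.
  pose W (i : 'I_p.+1) := if `[< S i >] then phi @^-1` [set i] `\` S0
                          else phi @^-1` [set i] `&` S0.
  have mW i : measurable (W i).
    by rewrite /W; case: ifP => _; [apply: measurableD|apply: measurableI].
  have W0 i : Pr (W i) = 0.
    rewrite /W; case: ifPn => /asboolP Si; last first.
      by apply/eqP; rewrite eq_le Pr_ge0 andbT leNgt; exact/negP.
    have iA : Pr (phi @^-1` [set i]) <= Pr A.
      apply: (@le_trans _ _ (Pr (iter (p - i) T @^-1` A `|` N))).
        apply: Pr_le => //; first exact: measurableU.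
        move=> x /= <-; have [|/good[j Aj ->]] := pselect (N x); [by right|by left].
      by rewrite (le_trans (Pr_setU _ _ _))// N0 addr0 (Pr_iter T_pres).
    have [h|//] := atom (phi @^-1` [set i]) S0 (mphi _) mS0 iA.
    by move: Si; rewrite /S /= h ltxx.
  apply: (@Pr_le0 _ _ _ mu _ (\bigcup_n W (inord n))) => //.
  - exact: bigcupT_measurable.
  - move=> x hx; exists (phi x) => //; rewrite inord_val /W.
    case: hx => -[h1 h2]; case: ifPn => /asboolP Sx.
    + by case: h2.
    + by [].
    + by [].
    + by case: Sx.
  - exact: Pr_bigcup0.
Qed.

Hypothesis T_aper : aperiodic_system mu T.

(** If the positive probabilities were bounded below, a set whose probability is
close enough to their infimum could not be split. *)
Lemma aperiodic_small_sets e : 0 < e -> exists C, [/\ measurable C, 0 < Pr C & Pr C < e].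
Proof.
move=> e0; apply: contrapT => /forallNP h.
have {}h C : measurable C -> 0 < Pr C -> e <= Pr C.
  by move=> mC C0; rewrite leNgt; apply/negP => Ce; apply: (h C); split.
pose S := [set r | exists C, [/\ measurable C, 0 < Pr C & r = Pr C]].
have hS : has_inf S.
  split; first by exists 1; exists setT; rewrite Pr_setT.
  by exists 0 => _ [C [_ C0 ->]]; exact: ltW.
have [_ [A [mA A0 ->]] hA] := inf_adherent e0 hS.
apply: T_aper; apply: (@periodic_of_atom A mA A0) => B S' mB mS' BA.
have mI : measurable (B `&` S') by exact: measurableI.
have mD : measurable (B `\` S') by exact: measurableD.
have [->|I0] := eqVneq (Pr (B `&` S')) 0; first by left.
have [->|D0] := eqVneq (Pr (B `\` S')) 0; first by right.
have I0' : 0 < Pr (B `&` S') by rewrite lt_neqAle eq_sym I0 Pr_ge0.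
have D0' : 0 < Pr (B `\` S') by rewrite lt_neqAle eq_sym D0 Pr_ge0.
have := h _ mD D0'.
have : inf S <= Pr (B `&` S') by apply: inf_lbound; [case: hS|exists (B `&` S')].
have := @Pr_setDI _ _ _ mu _ _ mB mS'.
by move: hA BA; lra.
Qed.

(** A small event is moved into [B] by a preimage of it that meets [B]. *)
Lemma aperiodic_small_subsets B e : measurable B -> 0 < Pr B -> 0 < e ->
  exists C, [/\ measurable C, C `<=` B, 0 < Pr C & Pr C <= e].
Proof.
move=> mB B0 e0; have [C [mC C0 Ce]] := aperiodic_small_sets e0.
have [n hn] := ergodic_hits mB mC B0 C0.
have mi : measurable (iter n.+1 T @^-1` C) := measurable_iter_preimage T_pres n.+1 mC.
exists (B `&` iter n.+1 T @^-1` C); split => //; first exact: measurableI.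
apply: le_trans (ltW Ce); rewrite -(Pr_iter T_pres n.+1 mC).
by apply: Pr_le => //; exact: measurableI.
Qed.

(** The level is the depth of a point in a nested sequence of events, each a small
part of the one before; the points of the null intersection get level 0. *)
Lemma rapid_level_function (q : nat -> R) : (forall j, 0 < q j) ->
  (forall j, q j <= 1 / 2) ->
  exists L : X -> nat, [/\ measurable_fun setT L,
    forall j, 0 < Pr [set x | (j <= L x)%N] &
    forall j, Pr [set x | (j.+1 <= L x)%N] <= q j * Pr [set x | (j <= L x)%N]].
Proof.
move=> q0 q2.
pose Bt := {B : set X | measurable B /\ 0 < Pr B}.
have B0t : measurable (@setT X) /\ 0 < Pr setT by rewrite Pr_setT.
have step (j : nat) (B : Bt) :
    {C : Bt | sval C `<=` sval B /\ Pr (sval C) <= q j * Pr (sval B)}.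
  apply: cid; case: B => B [mB B0] /=.
  have [C [mC CB C0 hC]] := aperiodic_small_subsets mB B0 (mulr_gt0 (q0 j) B0).
  by exists (exist _ C (conj mC C0)).
pose Bs := fix Bs n : Bt := if n is m.+1 then sval (step m (Bs m)) else exist _ _ B0t.
pose B n := sval (Bs n).
have mB n : measurable (B n) by rewrite /B; case: (Bs n) => ? [].
have PB n : 0 < Pr (B n) by rewrite /B; case: (Bs n) => ? [].
have BS n : B n.+1 `<=` B n by rewrite /B /=; case: (step n (Bs n)) => ? [].
have PS n : Pr (B n.+1) <= q n * Pr (B n) by rewrite /B /=; case: (step n (Bs n)) => ? [].
have Bmono m n : (m <= n)%N -> B n `<=` B m.
  by move=> /subnKC <-; elim: (n - m)%N => [|k IH]; rewrite ?addn0// addnS => x /BS /IH.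
pose Z := \bigcap_n B n; have mZ : measurable Z by exact: bigcapT_measurable.
have Z0 : Pr Z = 0.
  apply/eqP; rewrite eq_le Pr_ge0 andbT leNgt; apply/negP => Zp.
  have PB2 n : Pr (B n) <= (1 / 2) ^+ n.
    elim: n => [|n IH]; first by rewrite expr0 /B /= Pr_setT.
    rewrite exprS (le_trans (PS n))// ler_pM//; [exact: ltW|exact: Pr_ge0].
  have [n hn] := exists_nat_ge 1 Zp.
  have : Pr Z <= (1 / 2) ^+ n by apply: le_trans (PB2 n); apply: Pr_le => // x; apply.
  rewrite div1r exprVn -natrX => hZ.
  have n2 : (n < 2 ^ n)%N by exact: ltn_expl.
  have p0 : 0 < (2 ^ n)%:R :> R by rewrite ltr0n expn_gt0.
  move: hZ; rewrite -(ler_pM2r p0) mulVf ?gt_eqF// => hZ.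
  have : Pr Z * n%:R < Pr Z * (2 ^ n)%:R by rewrite ltr_pM2l// ltr_nat.
  lra.
have ex x : ~ Z x -> exists n, x \notin B n.+1.
  move=> /existsNP[[|n] /not_implyP[_ nB]]; first by exfalso; apply: nB.
  by exists n; apply/negP => /set_mem.
pose L x := if pselect (Z x) is right nZ then ex_minn (ex x nZ) else 0%N.
have LE j x : (j.+1 <= L x)%N <-> B j.+1 x /\ ~ Z x.
  rewrite /L; case: pselect => [Zx|nZ]; first by split => // -[].
  case: ex_minnP => m /negP nB mmin; split => [jm|[Bj _]].
    split => //; apply: contrapT => nBj.
    have /mmin : x \notin B j.+1 by apply/negP => /set_mem.
    by rewrite leqNgt jm.
  rewrite ltnNge; apply/negP => mj; apply: nB; apply/mem_set.
  by apply: Bmono Bj.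
have LEs j : [set x | (j.+1 <= L x)%N] = B j.+1 `\` Z.
  by apply/seteqP; split => x /= /LE.
have mL j : measurable [set x | (j <= L x)%N].
  case: j => [|j]; first by rewrite (_ : mkset _ = setT)//; apply/seteqP; split.
  by rewrite LEs; exact: measurableD.
have PL j : Pr [set x | (j <= L x)%N] = Pr (B j).
  case: j => [|j].
    by congr (Pr _); apply/seteqP; split.
  rewrite LEs [RHS](Pr_setDI mu (mB j.+1) mZ).
  rewrite [X in _ = _ + X](@Pr_le0 _ _ _ mu _ Z) ?addr0//; exact: measurableI.
exists L; split; [|by move=> j; rewrite PL|by move=> j; rewrite !PL].
move=> _ Y _; rewrite setTI.
have -> : L @^-1` Y =
    \bigcup_(n in Y) ([set x | (n <= L x)%N] `\` [set x | (n.+1 <= L x)%N]).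
  apply/seteqP; split => x /=.
    by move=> YL; exists (L x) => //; split => /=; rewrite ?ltnn.
  move=> [n Yn [/= nL /negP]]; rewrite -leqNgt => Ln.
  by have -> : L x = n by apply/eqP; rewrite eqn_leq Ln.
by apply: bigcup_measurable => n _; exact: measurableD.
Qed.

End small_sets.

(** * Trimmed sums of a function of the level *)

Lemma exists_superset_card (I : finType) (V : {set I}) k :
  (#|V| <= k)%N -> (k <= #|I|)%N -> exists2 J : {set I}, V \subset J & #|J| = k.
Proof.
move=> Vk kI.
have cC : (#|V| + #|~: V| = #|I|)%N by rewrite cardsC.
have : (0 < #|[set A : {set I} | A \subset ~: V & #|A| == (k - #|V|)%N]|)%N.
  by rewrite cards_draws bin_gt0; lia.
move=> /card_gt0P[A]; rewrite inE => /andP[AV /eqP cA].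
exists (V :|: A); first exact: finset.subsetUl.
rewrite cardsU cA (_ : V :&: A = finset.set0) ?cards0; first lia.
by apply/eqP; rewrite -finset.subset0 -(finset.setICr V) finset.setIS.
Qed.

Section trimmed_sums.
Context {R : realType} {X : Type}.
Variable T : X -> X.

(** Subtracting the largest sum over [k] indices amounts to minimising over the
choice of the indices to trim, so that any choice gives an upper bound. *)
Lemma trimmed_sum_min (g : X -> R) N k x : (k <= N)%N ->
  exists t : R, [/\ trimmed_sum T (EFin \o g) N k x = t%:E,
    exists2 J : {set 'I_N}, #|J| = k & t = \sum_(n in ~: J) g (iter n T x) &
    forall J : {set 'I_N}, #|J| = k -> t <= \sum_(n in ~: J) g (iter n T x)].
Proof.
move=> kN.
have [J0 _ J0k] : exists2 J : {set 'I_N}, finset.set0 \subset J & #|J| = k.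
  by apply: exists_superset_card; rewrite ?cards0// card_ord.
have sumC (J : {set 'I_N}) : \sum_(n in ~: J) g (iter n T x) =
    \sum_(n < N) g (iter n T x) - \sum_(n in J) g (iter n T x).
  rewrite [X in _ = X - _](bigID (mem J)) /= [RHS]addrC addKr.
  by apply: eq_bigl => n; rewrite inE.
have [J /eqP Jk EJ] := @eq_bigmax _ _ _ (-oo%E : \bar R) J0
  (fun J : {set 'I_N} => #|J| == k)
  (fun J => \sum_(n in J) (EFin \o g) (iter n T x))%E (introT eqP J0k)
  (fun _ _ => leNye _).
exists (\sum_(n in ~: J) g (iter n T x)); split.
- by rewrite /trimmed_sum EJ sumC !sumEFin EFinB.
- by exists J.
move=> K /eqP Kk; rewrite !sumC lerD2l lerN2 -lee_fin -!sumEFin.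
have := @le_bigmax_cond _ _ _ (-oo%E : \bar R) _ (fun J : {set 'I_N} => #|J| == k)
  (fun J => \sum_(n in J) (EFin \o g) (iter n T x))%E Kk.
by rewrite EJ.
Qed.

Variables (L : X -> nat) (a : nat -> R).
Hypothesis a_ge0 : forall j, 0 <= a j.
Hypothesis a_mono : forall i j, (i <= j)%N -> a i <= a j.
Local Notation W j := (visits T [set x | (j <= L x)%N]).

Let V N j x : {set 'I_N} := [set n : 'I_N | (j <= L (iter n T x))%N].

Let visits_card N j x : W j N x = #|V N j x|.
Proof.
rewrite /visits -sum1_card [RHS]big_mkcond /=; apply: eq_bigr => n _.
rewrite inE; case: ifPn => [h|/negP h]; first by rewrite mem_set.
by have [/set_mem|] := boolP (_ \in _).
Qed.

Lemma trimmed_sum_fin_num N k x : (k <= N)%N ->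
  trimmed_sum T (EFin \o (a \o L)) N k x \is a fin_num.
Proof. by move=> /(trimmed_sum_min (a \o L) x)[t [-> _ _]]. Qed.

(** At most [k] of the terms of level at least [j] are trimmed. *)
Lemma trimmed_sum_ge N k x j : (k <= N)%N ->
  a j * ((W j N x)%:R - k%:R) <= fine (trimmed_sum T (EFin \o (a \o L)) N k x).
Proof.
move=> /(trimmed_sum_min (a \o L) x)[t [-> [J Jk ->] _]] /=.
apply: (@le_trans _ _ (\sum_(n in V N j x :\: J) a j)).
  rewrite sumr_const -[leRHS]mulr_natr ler_wpM2l// lerBlDr -natrD ler_nat visits_card.
  rewrite -Jk -(cardsID J (V N j x)) addnC leq_add2l.
  by apply: subset_leq_card; apply: finset.subsetIr.
rewrite [leRHS](bigID (mem (V N j x))) /= -[leLHS]addr0 lerD//; last exact: sumr_ge0.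
rewrite (eq_bigl (fun n => (n \in ~: J) && (n \in V N j x))); last first.
  by move=> n; rewrite !inE.
by apply: ler_sum => n; rewrite !inE => /andP[_ h]; exact: a_mono.
Qed.

(** Trim all the terms of level at least [j], and arbitrary others up to the number [k]. *)
Lemma trimmed_sum_le_low N k x j : (k <= N)%N -> (W j N x <= k)%N ->
  fine (trimmed_sum T (EFin \o (a \o L)) N k x) <=
  \sum_(n < N | (L (iter n T x) < j)%N) a (L (iter n T x)).
Proof.
move=> kN; rewrite visits_card => Vk.
have [t [-> _ tmin]] := trimmed_sum_min (a \o L) x kN => /=.
have [|J VJ Jk] := exists_superset_card Vk; first by rewrite card_ord.
apply: le_trans (tmin J Jk) _ => /=.
rewrite [leRHS](bigID (mem (~: J))) /= -[leLHS]addr0 lerD//; last exact: sumr_ge0.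
rewrite [leRHS](eq_bigl (mem (~: J)))// => n; rewrite !inE.
apply: andb_idl; apply: contraNT; rewrite -leqNgt => h.
by apply: (fintype.subsetP VJ); rewrite inE.
Qed.

Lemma trimmed_sum_le_const N k x j : (k <= N)%N -> (W j.+1 N x <= k)%N ->
  fine (trimmed_sum T (EFin \o (a \o L)) N k x) <= a j * N%:R.
Proof.
move=> kN /(trimmed_sum_le_low kN)/le_trans; apply.
apply: (@le_trans _ _ (\sum_(n < N) a j)); last first.
  by rewrite sumr_const card_ord mulr_natr.
rewrite [leLHS]big_mkcond; apply: ler_sum => n _; case: ifP => // h; exact: a_mono.
Qed.

Lemma trimmed_sum_le N k x j : (k <= N)%N -> (W j.+2 N x <= k)%N ->
  fine (trimmed_sum T (EFin \o (a \o L)) N k x) <=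
  a j.+1 * (W j.+1 N x)%:R + a j * N%:R.
Proof.
move=> kN /(trimmed_sum_le_low kN)/le_trans; apply.
apply: (@le_trans _ _ (\sum_(n < N) (a j.+1 * (n \in V N j.+1 x)%:R + a j))); last first.
  rewrite big_split /= sumr_const card_ord -[a j *+ N]mulr_natr -mulr_sumr.
  rewrite visits_card -sum1_card natr_sum [X in _ <= _ * X + _]big_mkcond /=.
  by rewrite lerD2r ler_wpM2l// ler_sum// => n _; case: (n \in _).
rewrite [leLHS]big_mkcond; apply: ler_sum => n _; rewrite inE.
have := a_ge0 j.+1; have := a_ge0 j.
case: ltnP => h1; case: (leqP j.+1) => h2; rewrite ?mulr1 ?mulr0.
- by have /a_mono : (L (iter n T x) <= j.+1)%N by []; lra.
- have /a_mono : (L (iter n T x) <= j)%N by []; lra.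
- lra.
- lra.
Qed.

End trimmed_sums.

Lemma measurable_trimmed_sum d (R : realType) (X : measurableType d) (T : X -> X)
    (f : X -> \bar R) N k :
  measurable_fun setT T -> measurable_fun setT f ->
  measurable_fun setT (trimmed_sum T f N k).
Proof.
move=> mT mf.
have mi n : measurable_fun setT (f \o iter n T).
  apply: measurableT_comp => //; elim: n => [|n IH]; first exact: measurable_id.
  exact: measurableT_comp.
apply: emeasurable_funB.
  apply: (@emeasurable_sum _ _ _ _ _ _ (fun n : 'I_N => f \o iter n T)) => n.
  exact: mi.
elim: (index_enum _) => [|J s IH].
  rewrite (_ : (fun _ => _) = cst -oo%E); first exact: measurable_cst.
  by apply/funext => x; rewrite big_nil.
case: (boolP (#|J| == k)) => Jk; last first.
  rewrite (_ : (fun _ => _) = (fun x => \big[maxe/-oo%E]_(J <- s | #|J| == k)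
    \sum_(n in J) f (iter n T x))%E)//.
  by apply/funext => x; rewrite big_cons (negbTE Jk).
rewrite (_ : (fun _ => _) = (fun x => maxe (\sum_(n in J) f (iter n T x))
   (\big[maxe/-oo%E]_(J <- s | #|J| == k) \sum_(n in J) f (iter n T x)))%E); last first.
  by apply/funext => x; rewrite big_cons Jk.
apply: measurable_maxe => //.
rewrite (_ : (fun _ => _) = (fun x => \sum_(n <- enum J) (f \o iter n T) x)%E).
  by apply: emeasurable_sum => n; exact: mi.
by apply/funext => x; rewrite big_enum.
Qed.

(** * Scales, times and values *)

Section scales.
Context {R : realType}.

(** One summable sequence serves as relative error, as fraction of trimmed terms and
as probability of the exceptional events. *)
Definition tol (i : nat) : R := (1 / 2) ^+ (i + 3).

Lemma tol_gt0 i : 0 < tol i.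
Proof. by rewrite exprn_gt0//; lra. Qed.

Lemma tolS i : tol i.+1 = tol i / 2.
Proof. by rewrite /tol addSn exprS mulrC; lra. Qed.

Lemma tol_le i : tol i <= 1 / 8.
Proof.
elim: i => [|i IH]; first by rewrite /tol add0n !exprS expr0; lra.
by rewrite tolS; have := tol_gt0 i; lra.
Qed.

Lemma tol_mono i j : (i <= j)%N -> tol j <= tol i.
Proof.
move=> /subnKC <-; elim: (j - i)%N => [|k IH]; first by rewrite addn0.
by rewrite addnS tolS; have := tol_gt0 (i + k); lra.
Qed.

Lemma tol_geometric i : 2 * tol i <= 1 / (2 ^ i.+1)%:R.
Proof.
elim: i => [|i IH]; first by rewrite /tol add0n expn1 !exprS expr0; lra.
rewrite tolS expnS natrM invfM mulrA.
by move: IH; set z := _^-1 => IH; lra.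
Qed.

Lemma tol_small (e : R) : 0 < e -> exists i, 2 * tol i <= e.
Proof.
move=> e0; have [n hn] := exists_nat_ge 1 e0; exists n.
apply: (le_trans (tol_geometric n)).
have p0 : 0 < (2 ^ n.+1)%:R :> R by rewrite ltr0n expn_gt0.
rewrite ler_pdivrMr//.
have : e * n%:R <= e * (2 ^ n.+1)%:R.
  by rewrite ler_pM2l// ler_nat ltnW// (leq_trans (ltn_expl n (ltnSn 1)))// leq_exp2l.
lra.
Qed.

(** The regime [r n] is the index of the last time reached by [n]; before the first
time it is 0. *)
Lemma exists_regime (Ns : nat -> nat) : (forall i, (Ns i < Ns i.+1)%N) ->
  exists r : nat -> nat, [/\ forall i, r (Ns i) = i,
    forall i n, (Ns i <= n)%N -> (i <= r n)%N &
    forall n, (Ns 0 <= n)%N -> (Ns (r n) <= n)%N].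
Proof.
move=> incr.
have mono i j : (i <= j)%N -> (Ns i <= Ns j)%N.
  move=> /subnKC <-; elim: (j - i)%N => [|k IH]; first by rewrite addn0.
  by rewrite addnS (leq_trans IH)// ltnW.
have ex n : exists i, (n < Ns i.+1)%N.
  exists n; elim: n => [|n IH]; first exact: leq_ltn_trans (incr 0%N).
  exact: leq_ltn_trans (incr _).
pose r n := ex_minn (ex n).
have r1 n : (n < Ns (r n).+1)%N by rewrite /r; case: ex_minnP.
have r2 i n : (Ns i <= n)%N -> (i <= r n)%N.
  move=> h; rewrite leqNgt; apply/negP => /mono h2.
  by have := leq_trans (r1 n) (leq_trans h2 h); rewrite ltnn.
exists r; split => // [i|n n0].
  apply/eqP; rewrite eqn_leq r2// andbT /r; case: ex_minnP => k _; apply; exact: incr.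
case E : (r n) => [//|j]; rewrite leqNgt; apply/negP => h.
by move: E; rewrite /r; case: ex_minnP => k _ /(_ _ h) + kE; rewrite kE ltnn.
Qed.

(** The third property makes the terms below level [i.+1] negligible against a sum of
[p i.+1 * N] terms [a i.+1], and the integral infinite; the fourth separates
[a i.+1] from everything that the lower levels can add up to before [Ns i]. *)
Lemma exists_values (p : nat -> R) (Ns : nat -> nat) :
  (forall i, 0 < p i) -> (forall i, p i <= 1) ->
  exists a : nat -> R, [/\ forall i, 1 <= a i,
    forall i j, (i <= j)%N -> a i <= a j,
    forall i, a i <= tol i * p i.+1 * a i.+1 &
    forall i, 4 * (a i * (Ns i)%:R) < a i.+1].
Proof.
move=> p0 p1.
pose a := fix a i : R :=
  if i is j.+1 then a j * (4 * ((Ns j)%:R + 1)) / (tol j * p j.+1) else 1.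
have aS i : tol i * p i.+1 * a i.+1 = a i * (4 * ((Ns i)%:R + 1)).
  have t0 := tol_gt0 i; have pi := p0 i.+1.
  by rewrite /= mulrC mulfVK// mulf_neq0// gt_eqF.
have tp i : 0 < tol i * p i.+1 <= 1.
  rewrite mulr_gt0 ?tol_gt0//=; have := tol_le i; have := tol_gt0 i.
  by have := p0 i.+1; have := p1 i.+1; nra.
have step i : 0 < a i -> a i * (4 * ((Ns i)%:R + 1)) <= a i.+1.
  move=> ai; rewrite -aS; have /andP[h1 h2] := tp i.
  have : 0 < a i.+1.
    by rewrite -(pmulr_rgt0 _ h1) aS !mulr_gt0// ltr_wpDl.
  by move: (a i.+1) => b b0; nra.
have a1 i : 1 <= a i.
  elim: i => [//|i IH]; apply: le_trans (step i _); last lra.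
  by have : 0 <= (Ns i)%:R :> R by []; nra.
have aSle i : a i <= a i.+1.
  apply: le_trans (step i _); last by have := a1 i; lra.
  by have : 0 <= (Ns i)%:R :> R by []; have := a1 i; nra.
exists a; split => // [i j|i|i].
- move=> /subnKC <-; elim: (j - i)%N => [|k IH]; first by rewrite addn0.
  by rewrite addnS (le_trans IH).
- by rewrite aS; have : 0 <= (Ns i)%:R :> R by []; have := a1 i; nra.
- apply: lt_le_trans (step i _); last by have := a1 i; lra.
  by have : 0 <= (Ns i)%:R :> R by []; have := a1 i; nra.
Qed.

End scales.

Section times.
Context {d : measure_display} {R : realType} {X : measurableType d}.
Variables (mu : probability X R) (T : X -> X).
Hypothesis T_pres : probability_preserving mu T.
Hypothesis T_erg : ergodic mu T.
Local Notation Pr := (proba mu).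

(** The bounds on [m] hold because each of the two events of probability at least 1/8
meets the event, of probability more than 7/8, that the visits before [N] are
close to their mean number. *)
Lemma exists_time (A : set X) (e : R) M : measurable A -> 0 < Pr A -> Pr A <= 1 / 4 ->
  0 < e -> e <= 1 / 8 ->
  exists N m, [/\ (M < N)%N,
   [/\ 1 / 8 <= Pr [set x | (visits T A N x <= m)%N],
    1 / 8 <= Pr [set x | (m < visits T A N x)%N] & (m <= N)%N],
   e * Pr A * N%:R <= m%:R <= 2 * Pr A * N%:R &
   Pr [set x | exists n, (N <= n)%N /\
     e * Pr A * n%:R < `|(visits T A n x)%:R - Pr A * n%:R|] <= e].
Proof.
move=> mA A0 A4 e0 e8.
have eA0 : 0 < e * Pr A by exact: mulr_gt0.
have [M1 hM1] := visits_uniform T_pres T_erg mA eA0 e0.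
have [N [m [MN h1 h2]]] := visits_not_concentrated T_pres T_erg (M1 + M.+1) mA A0 A4.
have mtail n : measurable [set x | exists k, (n <= k)%N /\
     e * Pr A * k%:R < `|(visits T A k x)%:R - Pr A * k%:R|].
  exact: (measurable_tail_deviation T_pres).
have tail : Pr [set x | exists n, (N <= n)%N /\
     e * Pr A * n%:R < `|(visits T A n x)%:R - Pr A * n%:R|] < e.
  apply: le_lt_trans hM1; apply: Pr_le => // x [n [Nn h]]; exists n; split => //.
  by lia.
have mle : measurable [set x | (visits T A N x <= m)%N].
  exact: (measurable_visits_pred T_pres N (fun v => (v <= m)%N)).
have mlt : measurable [set x | (m < visits T A N x)%N].
  exact: (measurable_visits_pred T_pres N (fun v => (m < v)%N)).
have typical x : ~ (exists n, (N <= n)%N /\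
     e * Pr A * n%:R < `|(visits T A n x)%:R - Pr A * n%:R|) ->
   `|(visits T A N x)%:R - Pr A * N%:R| <= e * Pr A * N%:R.
  by move=> nh; rewrite leNgt; apply/negP => h; apply: nh; exists N.
have AN : 0 <= Pr A * N%:R by rewrite mulr_ge0// ltW.
have [|x [xm /(typical x) xt]] := @Pr_meet _ _ _ mu _ _ mle (measurableC (mtail N)).
- by rewrite Pr_setC//; lra.
have [|y [ym /(typical y) yt]] := @Pr_meet _ _ _ mu _ _ mlt (measurableC (mtail N)).
- by rewrite Pr_setC//; lra.
exists N, m; split => //.
- by lia.
- by split => //; rewrite (leq_trans (ltnW ym))// visits_le.
- have : (visits T A N x)%:R <= m%:R :> R by rewrite ler_nat.
  have : m%:R <= (visits T A N y)%:R :> R by rewrite ler_nat ltnW.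
  move: xt yt; rewrite !ler_norml -!mulrA; move: (Pr A * N%:R) AN => z z0.
  by move=> /andP[x1 x2] /andP[y1 y2] h3 h4; apply/andP; split; nra.
- exact: ltW.
Qed.

Lemma exists_times (A : nat -> set X) : (forall i, measurable (A i)) ->
  (forall i, 0 < Pr (A i)) -> (forall i, Pr (A i) <= 1 / 4) ->
  exists Ns m : nat -> nat, forall i, [/\ (Ns i < Ns i.+1)%N,
   [/\ 1 / 8 <= Pr [set x | (visits T (A i) (Ns i) x <= m i)%N],
    1 / 8 <= Pr [set x | (m i < visits T (A i) (Ns i) x)%N] & (m i <= Ns i)%N],
   tol i * Pr (A i) * (Ns i)%:R <= (m i)%:R <= 2 * Pr (A i) * (Ns i)%:R &
   Pr [set x | exists n, (Ns i <= n)%N /\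
     tol i * Pr (A i) * n%:R < `|(visits T (A i) n x)%:R - Pr (A i) * n%:R|] <= tol i].
Proof.
move=> mA A0 A4.
have step (iM : nat * nat) : {Nm : nat * nat | [/\ (iM.2 < Nm.1)%N,
   [/\ 1 / 8 <= Pr [set x | (visits T (A iM.1) Nm.1 x <= Nm.2)%N],
    1 / 8 <= Pr [set x | (Nm.2 < visits T (A iM.1) Nm.1 x)%N] & (Nm.2 <= Nm.1)%N],
   tol iM.1 * Pr (A iM.1) * Nm.1%:R <= Nm.2%:R <= 2 * Pr (A iM.1) * Nm.1%:R &
   Pr [set x | exists n, (Nm.1 <= n)%N /\ tol iM.1 * Pr (A iM.1) * n%:R <
       `|(visits T (A iM.1) n x)%:R - Pr (A iM.1) * n%:R|] <= tol iM.1]}.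
  case: iM => i M; apply: cid.
  have [N [m h]] := exists_time M (mA i) (A0 i) (A4 i) (tol_gt0 i) (tol_le i).
  by exists (N, m).
pose s := fix s i :=
  if i is j.+1 then sval (step (i, (s j).1)) else sval (step (0%N, 0%N)).
exists (fun i => (s i).1), (fun i => (s i).2) => i.
split.
- by rewrite /=; case: (step _) => ? [].
all: by case: i => [|i] /=; case: (step _) => ? [].
Qed.

Lemma borel_cantelli_tol (F : nat -> set X) : (forall i, measurable (F i)) ->
  (forall i, Pr (F i) <= 2 * tol i) ->
  {ae mu, forall x, exists I, forall i, (I <= i)%N -> ~ F i x}.
Proof.
move=> mF hF; exists (lim_sup_set F); split.
- by apply: bigcapT_measurable => n; apply: bigcup_measurable.
- apply: lim_sup_set_cvg0 => //.
  apply: (@le_lt_trans _ _ (\sum_(i <oo) (1 / (2 ^ i.+1)%:R)%:E)%E).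
    apply: lee_nneseries => [i _ _|i _]; first exact: measure_ge0.
    suff : ((Pr (F i))%:E <= (1 / (2 ^ i.+1)%:R)%:E)%E by rewrite -PrE.
    rewrite lee_fin; exact: le_trans (hF i) (tol_geometric i).
  by rewrite (le_lt_trans (epsilon_trick0 _ _))// ltry.
- move=> x /= /forallNP h n _; have /existsNP[i /not_implyP[ni /contrapT Fi]] := h n.
  by exists i.
Qed.

End times.

(** * Assembling the example *)

Lemma littleo_natP (R : realType) (k : nat -> nat) :
  (forall e : R, 0 < e -> exists n0, forall n, (n0 <= n)%N -> (k n)%:R <= e * n%:R) ->
  (fun n => (k n)%:R : R) =o_\oo (fun n => n%:R : R).
Proof.
move=> h; apply/eqoP => e e0; have [n0 hn] := h e e0.
by exists n0 => // n /= /hn; rewrite !normr_nat.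
Qed.

Lemma limn_esup_ge (R : realType) (u : nat -> \bar R) (c : \bar R) :
  (forall n, exists n', (n <= n')%N /\ (c <= u n')%E) -> (c <= limn_esup u)%E.
Proof.
move=> h; rewrite limn_esup_lim (cvg_lim _ (@cvg_esups_inf _ u))//.
apply: le_ereal_inf_tmp => _ [n _ <-].
have [n' [nn' cu]] := h n; apply: le_trans cu _.
by apply: ereal_sup_ubound; exists n'.
Qed.

Section two_scales.
Context {d : measure_display} {R : realType} {X : measurableType d}.
Variable mu : probability X R.
Local Notation Pr := (proba mu).

(** If [D >= 2 * alpha], the quotient is at most 1/2 on [A]; otherwise it is at least
2 on [B]. *)
Lemma spread_not_normalizable (S : X -> \bar R) (A B : set X) (alpha beta D : R) :
  measurable_fun setT S -> (forall x, S x \is a fin_num) ->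
  measurable A -> measurable B ->
  0 <= alpha -> 4 * alpha < beta -> 0 < D ->
  (forall x, A x -> fine (S x) <= alpha) -> (forall x, B x -> beta <= fine (S x)) ->
  1 / 8 <= Pr A -> 1 / 8 <= Pr B ->
  ((1 / 8)%:E <= mu [set x | (1 / 3)%:E < `| S x / D%:E - 1 |])%E.
Proof.
move=> mS finS mA mB a0 ab D0 hA hB PA PB; set E := [set x | _].
have mE : measurable E.
  rewrite -[E]setTI; apply: emeasurable_fun_o_infty => //.
  apply: measurableT_comp => //; apply: emeasurable_funB => //.
  exact: emeasurable_funM.
have EE x : E x = (1 / 3 < `|fine (S x) / D - 1|) :> Prop.
  by rewrite /E /= -{1}(fineK (finS x)) inver gt_eqF// -EFinM -EFinB abse_EFin lte_fin.
rewrite (PrE mu mE) lee_fin.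
have [Da|Da] := leP (2 * alpha) D.
  apply: (le_trans PA); apply: Pr_le => // x /hA Sx; rewrite EE.
  have : fine (S x) / D <= 1 / 2 by rewrite ler_pdivrMr//; lra.
  by move=> h; rewrite lter_normr; apply/orP; right; lra.
apply: (le_trans PB); apply: Pr_le => // x /hB Sx; rewrite EE.
have : 2 <= fine (S x) / D by rewrite ler_pdivlMr//; lra.
by move=> h; rewrite lter_normr; apply/orP; left; lra.
Qed.

(** By the Markov inequality the integral is at least [a j] times the probability of
level at least [j], for every [j]. *)
Lemma level_class_F (L : X -> nat) (a : nat -> R) :
  measurable_fun setT L -> (forall j, 0 <= a j) ->
  (forall i j, (i <= j)%N -> a i <= a j) ->
  (forall c, exists j, c <= a j * Pr [set x | (j <= L x)%N]) ->
  class_F mu (EFin \o (a \o L)).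
Proof.
move=> mL a0 amono hc.
have mf : measurable_fun setT (EFin \o (a \o L)).
  apply/measurable_EFinP => _ Y _; rewrite setTI.

  exact: (measurable_nat_pred (fun l => Y (a l)) mL).
split => //.
- by move=> x /=; rewrite lee_fin.
- apply: eq_infty => c; have [j hj] := hc c.
  have mj : measurable [set x | (j <= L x)%N].
    exact: (measurable_nat_pred (fun l => (j <= l)%N) mL).
  apply: (@le_trans _ _ (\int[mu]_x (a j * \1_[set x | (j <= L x)%N] x)%:E)%E).
    under eq_integral do rewrite EFinM.
    rewrite ge0_integralZl//; last 2 first.
    - by apply/measurable_EFinP; exact: measurable_indic.
    - by rewrite lee_fin.
    rewrite integral_indic// setIT.
    suff : (c%:E <= (a j)%:E * (Pr [set x | (j <= L x)%N])%:E)%E by rewrite -PrE.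
    by rewrite -EFinM lee_fin.
  apply: ge0_le_integral => //.
  - by move=> x _; rewrite lee_fin mulr_ge0.
  - apply/measurable_EFinP; apply: measurable_funM => //; exact: measurable_indic.
  - move=> x _ /=; rewrite lee_fin indicE.
    have [/set_mem/= h|_] := boolP (x \in _); last by rewrite mulr0.
    by rewrite mulr1; exact: amono.
- by rewrite (_ : mkset _ = set0) ?measure0//; apply/seteqP; split.
Qed.
End two_scales.

Theorem theorem3 (R : realType) (d : measure_display) (X : measurableType d)
    (mu : probability X R) (T : X -> X)
    (T_pres : probability_preserving mu T)
    (T_erg : ergodic mu T)
    (T_aper : aperiodic_system mu T) :
  exists (f : X -> \bar R) (k : nat -> nat),
    [/\ class_F mu f,
        trimming_sequence k,
        (fun N => (k N)%:R : R) =o_\oo (fun N => N%:R : R),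
        exists2 dN : nat -> R, (forall N, 0 < dN N) &
          {ae mu, forall x,
            (trimmed_sum T f N (k N) x / (dN N)%:E)%E @[N --> \oo] --> 1%E}
      & exists k' : nat -> nat,
        [/\ trimming_sequence k',
            (fun N => (k' N)%:R : R) =o_\oo (fun N => N%:R : R),
            forall N, (k N <= k' N)%N
          & forall d' : nat -> R, (forall N, 0 < d' N) ->
              exists2 e : R, 0 < e &
                (0 < limn_esup (fun N => mu [set x |
                   e%:E < `| trimmed_sum T f N (k' N) x / (d' N)%:E - 1 |]))%E]].
Proof.
have tol2 j : 0 < (tol j : R) ^+ 2 by rewrite exprn_gt0// tol_gt0.
have tol2h j : (tol j : R) ^+ 2 <= 1 / 64.
  by have := @tol_gt0 R j; have := @tol_le R j; rewrite expr2; nra.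
have [|L [mL p0 pS]] := rapid_level_function T_pres T_erg T_aper tol2.
  by move=> j; have := tol2h j; lra.
pose A j := [set x | (j <= L x)%N]; pose p j := proba mu (A j).
have mA j : measurable (A j) by exact: (measurable_nat_pred (fun l => (j <= l)%N) mL).
have p1 j : p j <= 1 by exact: Pr_le1.
have p4 j : p j.+1 <= 1 / 4.
  apply: (le_trans (pS j)); have := p1 j; have := p0 j; rewrite -/(p j).
  by have := tol2h j; have := tol2 j; nra.
have ptol j : p j.+1 <= tol j.
  apply: (le_trans (pS j)); have := p1 j; have := p0 j; rewrite -/(p j) expr2.
  by have := @tol_gt0 R j; have := @tol_le R j; nra.
(* Level [i.+1] dominates the trimmed sums from the time [Ns i] on, until [Ns i.+1];
level 0 is all of [X], where visits do not fluctuate. *)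
have [Ns [m H]] := exists_times T_pres T_erg (fun i => mA i.+1) (fun i => p0 i.+1) p4.
have Nincr i : (Ns i < Ns i.+1)%N by have [] := H i.
have [r [rN r_ge r_le]] := exists_regime Nincr.
have Ngei i : (i <= Ns i)%N by elim: i => // i IH; exact: leq_ltn_trans (Nincr i).
have [a [a1 amono asmall ajump]] := exists_values Ns p0 p1.
have a0 j : 0 <= a j by apply: le_trans (a1 j).
pose f : X -> \bar R := EFin \o (a \o L).
pose k n := Num.truncn (tol (r n) * p (r n).+1 * n%:R).
pose k' n := if n == Ns (r n) then m (r n) else k n.
(* The [maxn] only keeps [dN 0] positive. *)
pose dN n : R := a (r n).+1 * p (r n).+1 * (maxn 1 n)%:R.
have agt0 i : 0 < a i by exact: lt_le_trans (a1 i).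
have dN0 n : 0 < dN n.
  by rewrite mulr_gt0 ?ltr0n ?leq_maxl// mulr_gt0//; exact: p0.
have tp i : 0 < tol i * p i.+1 by rewrite mulr_gt0 ?tol_gt0//; exact: p0.
have kle n : (k n)%:R <= tol (r n) * p (r n).+1 * n%:R.
  by rewrite Num.Theory.truncn_le mulr_ge0// ltW.
have ktol n : (k n)%:R <= 2 * tol (r n) * n%:R :> R.
  apply: (le_trans (kle n)); rewrite ler_wpM2r//.
  have := @tol_gt0 R (r n); have := p1 (r n).+1; have := p0 (r n).+1.
  by rewrite -/(p _); nra.
have kk' n : (k n <= k' n)%N.
  rewrite /k'; case: eqP => // nE; have [_ _ /andP[h _] _] := H (r n).
  by move: h; rewrite -nE -(ler_nat R); exact: le_trans (kle n).
have k'tol n : (k' n)%:R <= 2 * tol (r n) * n%:R :> R.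
  rewrite /k'; case: eqP => // nE; have [_ _ /andP[_ h] _] := H (r n).
  apply: (le_trans h); rewrite -nE ler_wpM2r// ler_wpM2l//; exact: ptol.
have small (g : nat -> nat) : (forall n, (g n)%:R <= 2 * tol (r n) * n%:R :> R) ->
    (fun n => (g n)%:R : R) =o_\oo (fun n => n%:R : R).
  move=> hg; apply: littleo_natP => e /tol_small[i hi]; exists (Ns i) => n /r_ge ir.
  apply: (le_trans (hg n)); rewrite ler_wpM2r//; apply: le_trans hi.
  by rewrite ler_wpM2l//; exact: tol_mono.
have k'n n : (k' n <= n)%N.
  rewrite -(ler_nat R) (le_trans (k'tol n))// ler_piMl//.
  by have := @tol_le R (r n); lra.
have kn n : (k n <= n)%N := leq_trans (kk' n) (k'n n).
have fF : class_F mu f.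
  apply: level_class_F => // c.
  have [i hi] := exists_nat_ge c (@ltr01 R).
  have [n hn] : exists n, 2 * tol n <= 1 / (1 + i%:R) :> R.
    by apply: tol_small; rewrite divr_gt0// ltr_pwDl.
  exists n.+1; have := asmall n; rewrite -/(A _) -/(p _).
  have i0 : 0 < 1 + i%:R :> R by rewrite ltr_pwDl.
  move: hn; rewrite ler_pdivlMr// => hn; rewrite -mulrA (mulrC (p _)).
  have := @tol_gt0 R n; have := a1 n; move: hi.
  by move: (a n.+1 * p n.+1) => y hi a1n t0 h; rewrite -(ler_pM2l t0); nra.
exists f, k; split => //.
- exact: small.
- exists dN => //.
  (* [F1 i]: the visits to level [i.+1] deviate from their mean number after time
  [Ns i]; [F2 i]: at some time the visits to level [i.+2] may be too many
  to be all trimmed. *)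
  pose F1 i := [set x | exists n, (Ns i <= n)%N /\
     tol i * p i.+1 * n%:R < `|(visits T (A i.+1) n x)%:R - p i.+1 * n%:R|].
  pose F2 i := [set x | exists n, (0 < n)%N /\
     tol i * p i.+1 * n%:R <= (visits T (A i.+2) n x)%:R].
  have mF1 i : measurable (F1 i) by exact: (measurable_tail_deviation T_pres).
  have mF2 i : measurable (F2 i) by exact: (measurable_frequent T_pres).
  have PF2 i : proba mu (F2 i) <= tol i.
    have := maximal_inequality T_pres (mA i.+2) (ltW (tp i)); rewrite -/(F2 i) => h.
    rewrite -(ler_pM2l (tp i)); apply: (le_trans h); apply: (le_trans (pS i.+1)).
    rewrite -/(A i.+1) -/(p i.+1) [leRHS]mulrAC ler_wpM2r//; first by rewrite ltW// p0.
    rewrite tolS expr2; have := @tol_gt0 R i; nra.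
  have [||Z [mZ Z0 hZ]] := @borel_cantelli_tol _ _ _ mu (fun i => F1 i `|` F2 i).
  - by move=> i; exact: measurableU.
  - move=> i; rewrite (le_trans (Pr_setU _ (mF1 i) (mF2 i)))//.
    by have [_ _ _ h] := H i; have := PF2 i; move: h; rewrite -/(p i.+1) -/(F1 i); lra.
  exists Z; split => // x /= nx; apply: hZ => /= -[I hI]; apply: nx.
  have fin n : trimmed_sum T f n (k n) x \is a fin_num by exact: trimmed_sum_fin_num.
  have -> : (fun N => trimmed_sum T f N (k N) x / (dN N)%:E)%E =
      EFin \o (fun N => fine (trimmed_sum T f N (k N) x) / dN N).
    apply/funext => n /=; rewrite -{1}(fineK (fin n)) inver gt_eqF// EFinM.
  apply/fine_cvgP; split; first exact: nearW.
  apply/cvgrPdist_le => e e0; have [i hi] := tol_small e0.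
  exists (maxn 1 (Ns (maxn i I))) => // n /=; rewrite geq_max => /andP[n0 nN].
  have := r_ge _ _ nN; rewrite geq_max => /andP[ir Ir].
  have Nr : (Ns (r n) <= n)%N.
    apply: r_le; apply: leq_trans nN.
    elim: (maxn i I) => // j IH; exact: leq_trans IH (ltnW (Nincr j)).
  have /not_orP[/forallNP nF1 /forallNP nF2] := hI _ Ir.
  have {nF1}nF1 : `|(visits T (A (r n).+1) n x)%:R - p (r n).+1 * n%:R| <=
      tol (r n) * p (r n).+1 * n%:R.
    by rewrite leNgt; apply/negP => h; apply: (nF1 n).
  have {nF2}nF2 : (visits T (A (r n).+2) n x <= k n)%N.
    rewrite Num.Theory.truncn_ge_nat; last by rewrite mulr_ge0// ltW.
    by rewrite leNgt; apply/negP => h; apply: (nF2 n); split => //; exact: ltW.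
  have lo := @trimmed_sum_ge _ _ T L a a0 amono n (k n) x (r n).+1 (kn n).
  have up := @trimmed_sum_le _ _ T L a a0 amono n (k n) x (r n) (kn n) nF2.
  have hk := kle n; have as' := asmall (r n).
  rewrite /dN (maxn_idPr n0) distrC.
  move: nF1 lo up hk as'; rewrite -/(A _) -/f.
  move: (visits T _ n x)%:R (k n)%:R (fine _) => w kk t.
  have t0 := @tol_gt0 R (r n); have tle : 2 * tol (r n) <= e.
    by apply: le_trans hi; rewrite ler_wpM2l//; exact: tol_mono.
  have ap := agt0 (r n).+1.
  have pp : 0 < p (r n).+1 by exact: p0.
  have nn : 0 < n%:R :> R by rewrite ltr0n.
  rewrite ler_norml => /andP[w1 w2] lo up hk as'.
  have D0 : 0 < a (r n).+1 * p (r n).+1 * n%:R by rewrite !mulr_gt0.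
  (* Deviation of the visits and trimming each cost a relative error [tol (r n)] below;
  deviation and the lower levels each cost one above. *)
  have -> : t / (a (r n).+1 * p (r n).+1 * n%:R) - 1 =
     (t - a (r n).+1 * p (r n).+1 * n%:R) / (a (r n).+1 * p (r n).+1 * n%:R).
    by rewrite mulrBl divff// gt_eqF.
  rewrite normrM normfV (gtr0_norm D0) ler_pdivrMr//.
  apply: (@le_trans _ _ (2 * tol (r n) * (a (r n).+1 * p (r n).+1 * n%:R))); last first.
    by rewrite ler_wpM2r// ltW.
  have h1 : a (r n) * n%:R <= tol (r n) * p (r n).+1 * a (r n).+1 * n%:R.
    by rewrite ler_wpM2r.
  have h2 : a (r n).+1 * w <=
      a (r n).+1 * (p (r n).+1 * n%:R + tol (r n) * p (r n).+1 * n%:R).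
    by rewrite ler_pM2l//; lra.
  have h3 : a (r n).+1 * (p (r n).+1 * n%:R - tol (r n) * p (r n).+1 * n%:R
      - tol (r n) * p (r n).+1 * n%:R) <= a (r n).+1 * (w - kk).
    by rewrite ler_pM2l//; lra.
  by rewrite ler_norml; apply/andP; split; lra.
exists k'; split => //; first exact: small.
move=> d' d'0; exists (1 / 3); first lra.
apply: (@lt_le_trans _ _ (1 / 8)%:E); first by rewrite lte_fin; lra.
apply: limn_esup_ge => n; exists (Ns n); split => //.
have [_ [h1 h2 h3] _ _] := H n.
have k'E : k' (Ns n) = m n by rewrite /k' rN eqxx.
rewrite k'E.
apply: (@spread_not_normalizable _ _ _ mu _
  [set x | (visits T (A n.+1) (Ns n) x <= m n)%N]
  [set x | (m n < visits T (A n.+1) (Ns n) x)%N] (a n * (Ns n)%:R) (a n.+1)) => //.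
- by apply: measurable_trimmed_sum; [case: T_pres|case: fF].
- by move=> x; exact: trimmed_sum_fin_num.
- exact: (measurable_visits_pred T_pres (Ns n) (fun v => (v <= m n)%N)).
- exact: (measurable_visits_pred T_pres (Ns n) (fun v => (m n < v)%N)).
- exact: mulr_ge0.
- by move=> x /= h; apply: trimmed_sum_le_const.
- move=> x /= h; apply: le_trans (@trimmed_sum_ge _ _ T L a a0 amono _ _ x n.+1 h3).
  by rewrite ler_peMr// lerBrDr nat1r ler_nat.
Qed.
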